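(* Let $N$ be a natural number and let $A \subseteq [0,1]^N$ be a set of positive Lebesgue measure. Let $\{ f_n \}_{n \in \mathbb{Z}^N}$ be the Fourier frame for $L^2(A)$. If $\mathbb{Z}^N$ can be partitioned into finitely many subsets $\{ A_l: 1 \le l \le L \}$ such that for $1 \le l \le L$, $\{ f_n: n \in A_l \}$ is a Riesz basic sequence, then $\mathbb{Z}^N$ can be partitioned into $K$ syndetic subsets $\{ S_k: 1 \le k \le K \}$ with $K \le L$ such that for $1 \le k \le K$, $\{ f_n: n \in S_k \}$ is a Riesz basic sequence.
   Context: For $t=(t_1,\dots,t_N) \in [0,1]^N$ and $n=(n_1,\dots,n_N) \in \mathbb{Z}^N$, set $n \cdot t = n_1t_1+\cdots+n_Nt_N$ and $e_n(t) = e^{2\pi i n\cdot t}$. For a measurable set $A \subseteq [0,1]^N$ of positive Lebesgue measure, $L^2(A)$ is the Hilbert space of square-integrable functions on $A$ (with respect to Lebesgue measure), and the Fourier frame for $L^2(A)$ is the family $f_n = e_n \chi_A$, $n \in \mathbb{Z}^N$ (the restrictions of the exponentials $e_n$ to $A$). A subset $S \subseteq \mathbb{Z}^N$ is called syndetic if there exists a finite set $F \subseteq \mathbb{Z}^N$ such that $\mathbb{Z}^N = \bigcup_{m \in F} (-m+S)$. A family $\{f_i\}_{i\in J}$ in a Hilbert space (indexed by $J$) is a Riesz basic sequence if there are constants $0<a\le b<\infty$ such that $a \sum_{i} |c_i|^2 \le \| \sum_{i} c_i f_i \|^2 \le b \sum_i |c_i|^2$ for all finitely supported families of scalars $(c_i)_{i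 \in J}$. *)

(* Defs.v *)
From HB Require Import structures.
From mathcomp Require Import all_boot all_order all_algebra.
From mathcomp Require Import all_classical all_reals all_analysis.
From mathcomp Require Import complex.

Set Implicit Arguments.
Unset Strict Implicit.
Unset Printing Implicit Defensive.
Import Order.TTheory GRing.Theory Num.Theory.
Import numFieldNormedType.Exports.

Local Open Scope classical_set_scope.
Local Open Scope ring_scope.

(* Lebesgue measure on R^N, with R^N represented as N.-tuple R: iterated
   product of lebesgue_measure on the Borel sets, followed by completion
   (Caratheodory extension), so that the measurable sets are exactly the
   Lebesgue measurable ones. *)

Section lebesgue_cons.
Variables (R : realType) (N : nat).
Variable mu :
  {sigma_finite_measure set (N.-tuple (measurableTypeR R)) -> \bar R}.

Let T1 := (measurableTypeR R * N.-tuple (measurableTypeR R))%type.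

Definition tuple_cons (p : T1) : N.+1.-tuple (measurableTypeR R) :=
  [tuple of p.1 :: p.2].

Let leb : {sigma_finite_measure set (measurableTypeR R) -> \bar R} :=
  @lebesgue_measure R.

Definition lebesgue_cons : set (N.+1.-tuple (measurableTypeR R)) -> \bar R :=
  pushforward (leb \x mu)%E tuple_cons.

Let measurable_tuple_cons : measurable_fun [set: T1] tuple_cons.
Proof. exact: measurable_cons. Qed.

HB.instance Definition _ := Measure.copy lebesgue_cons
  (@measure_function_pushforward__canonical__measure_function_Measure
     _ _ _ _ _ _ _ measurable_tuple_cons).

Let lebesgue_cons_sigma_finite : sigma_finite setT lebesgue_cons.
Proof.
have /sigma_finiteP[F [TF ndF Foo]] := sigma_finiteT leb.
have /sigma_finiteP[G [TG ndG Goo]] := sigma_finiteT mu.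
exists (fun n => (@tnth _ _ ^~ ord0) @^-1` F n `&`
    (fun t : N.+1.-tuple (measurableTypeR R) => [tuple of behead t]) @^-1` G n).
  rewrite predeqE => t; split=> // _.
  have [k _ Fk] : (\bigcup_k F k) (tnth t ord0) by rewrite -TF.
  have [l _ Gl] : (\bigcup_k G k) [tuple of behead t] by rewrite -TG.
  exists (maxn k l) => //; split => /=.
  - by move: Fk; exact/subsetPset/ndF/leq_maxl.
  - by move: Gl; exact/subsetPset/ndG/leq_maxr.
move=> k; have [mF Fk] := Foo k; have [mG Gk] := Goo k; split.
  apply: measurableI.
    by rewrite -[X in measurable X]setTI; exact: measurable_tnth.
  by rewrite -[X in measurable X]setTI; exact: measurable_behead.
rewrite /lebesgue_cons /pushforward.
set X := (X in (_ \x _)%E X).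
have -> : X = F k `*` G k.
  rewrite /X predeqE => -[x v]; rewrite /tuple_cons /=.
  have -> : [tuple of behead [tuple of x :: v]] = v by exact: val_inj.
  by [].
by rewrite product_measure1E// lte_mul_pinfty// ge0_fin_numE.
Qed.

HB.instance Definition _ := Measure_isSigmaFinite.Build _ _ _ lebesgue_cons
  lebesgue_cons_sigma_finite.

End lebesgue_cons.

Fixpoint borel_lebesgue (R : realType) (N : nat) :
    {sigma_finite_measure set (N.-tuple (measurableTypeR R)) -> \bar R} :=
  match N with
  | 0 => @dirac _ (0.-tuple (measurableTypeR R)) [tuple] R
  | N'.+1 => lebesgue_cons (borel_lebesgue R N')
  end.

Definition lebesgue_space (R : realType) (N : nat) : Type :=
  caratheodory_type (borel_lebesgue R N)^*%mu.

HB.instance Definition _ (R : realType) (N : nat) :=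
  Measurable.copy (lebesgue_space R N)
    (caratheodory_type (borel_lebesgue R N)^*%mu).

Definition lebesgue_nd {R : realType} {N : nat} :
    set (lebesgue_space R N) -> \bar R :=
  @completed_measure_extension _ _ _ (borel_lebesgue R N).

HB.instance Definition _ (R : realType) (N : nat) :=
  Measure.copy (@lebesgue_nd R N)
    (@completed_measure_extension _ _ _ (borel_lebesgue R N)).

Definition point_coord (R : realType) (N : nat) (t : lebesgue_space R N) (i : 'I_N)
  : R := tnth (t : N.-tuple R) i.

Definition unit_cube {R : realType} {N : nat} : set (lebesgue_space R N) :=
  [set t | forall i, 0 <= point_coord t i <= 1].

Definition expC (R : realType) (z : R[i]) : R[i] :=
  (expR (complex.Re z))%:C%C *
  Complex (cos (complex.Im z)) (sin (complex.Im z)).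

Definition dotp (R : realType) (N : nat) (n : 'rV[int]_N)
    (t : lebesgue_space R N) : R :=
  \sum_(i < N) (n ord0 i)%:~R * point_coord t i.

Definition exp_dot (R : realType) (N : nat) (n : 'rV[int]_N)
    (t : lebesgue_space R N) : R[i] :=
  expC (2 * (pi : R)%:C%C * 'i%C * (dotp n t)%:C%C).

(* The codomain is R[i]^o so that functions form an R[i]-module. *)
Definition fourier_frame (R : realType) (N : nat) (A : set (lebesgue_space R N))
    (n : 'rV[int]_N) : lebesgue_space R N -> R[i]^o :=
  fun t => exp_dot n t * (\1_A t)%:C%C.

(* The norm of L^2(A), computed on representatives. *)
Definition L2norm (R : realType) (N : nat) (A : set (lebesgue_space R N))
    (f : lebesgue_space R N -> R[i]^o) : \bar R :=
  Lnorm (@lebesgue_nd R N) 2%:E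
    ((fun t => (ComplexField.Normc.normc (f t))%:E) \_ A).

(* The family indexed by J that is the restriction of f to J; only the
   values of c on J matter. *)
Definition riesz_basic_sequence (R : realType) (V : lmodType R[i])
    (nrm : V -> \bar R) (I : choiceType) (J : set I) (f : I -> V) : Prop :=
  exists a b : R, [/\ 0 < a, a <= b &
    forall c : I -> R[i], finite_set (J `&` [set i | c i != 0]) ->
      let s := \sum_(i \in J) ComplexField.Normc.normc (c i) ^+ 2 in
      let x := nrm (\sum_(i \in J) c i *: f i) in
      ((a * s)%:E <= x ^+ 2)%E /\ (x ^+ 2 <= (b * s)%:E)%E].

Definition syndetic (G : zmodType) (S : set G) : Prop :=
  exists2 F : set G, finite_set F &
    \bigcup_(m in F) [set - m + s | s in S] = setT.

(* Empty blocks are allowed. *)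
Definition partitioned_into (T : Type) (L : nat) (B : 'I_L -> set T) : Prop :=
  trivIset setT B /\ cover setT B = setT.

(* Main.v *)
(* Since |e_n| = 1, translating the index set does not change the norm of a
   linear combination, so the Riesz bounds of B hold on every S all of whose
   finite subsets can be translated into B. If a block B_k is not syndetic,
   arbitrarily large finite windows have translates missing B_k; the limit of
   the correspondingly translated partitions along an ultrafilter is a partition
   with empty k-th block whose blocks still embed finitely into the B_l. The
   number of blocks thus decreases until all of them are syndetic. *)

Require Import Defs.
From mathcomp Require Import all_boot all_order all_algebra.
From mathcomp Require Import all_classical all_reals all_analysis.
From mathcomp Require Import complex finmap ring.

Set Implicit Arguments.
Unset Strict Implicit.
Unset Printing Implicit Defensive.
Import Order.TTheory GRing.Theory Num.Theory.

Local Open Scope classical_set_scope.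
Local Open Scope ring_scope.

Definition finitely_embeds (G : zmodType) (S B : set G) : Prop :=
  forall F : set G, finite_set F -> F `<=` S ->
    exists g, forall n, F n -> B (g + n).

(** If every window [g + F] met [B], say at [g + m], then [g = - m + (g + m)] would exhibit [F] as a
    witness of syndeticity. *)
Lemma not_syndeticP (G : zmodType) (B : set G) :
  ~ syndetic B ->
  forall F, finite_set F -> exists g, forall m, F m -> ~ B (g + m).
Proof.
move=> nB F finF; apply: contrapT => nG; apply: nB; exists F => //.
apply/seteqP; split=> // g _; apply: contrapT => ng; apply: nG.
exists g => m Fm Bgm; apply: ng; exists m => //; exists (g + m) => //.
by rewrite addrC addrK.
Qed.

Lemma avoid_nonsyndetic (G : zmodType) (L : nat) (B : 'I_L -> set G)
    (k : 'I_L) :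
  partitioned_into B -> ~ syndetic (B k) ->
  exists S : 'I_L -> set G, [/\ partitioned_into S, S k = set0 &
    forall l, finitely_embeds (S l) (B l)].
Proof.
move=> [trivB coverB] /not_syndeticP nB.
pose avoid (F : set G) := [set g | forall m, F m -> ~ B k (g + m)].
(* The sets [avoid F] form a filter base: avoiding a union of two windows means avoiding both, and
   none is empty since [B k] is not syndetic. *)
have avoid_proper : ProperFilter (filter_from finite_set avoid).
  apply: filter_from_proper; last by move=> F /nB.
  apply: filter_from_filter; first by exists set0.
  move=> F F' finF finF'; exists (F `|` F'); first by rewrite finite_setU.
  by move=> g ag; split=> m Fm; apply: ag; [left|right].
have [U [ultraU avoidU]] := ultraFilterLemma avoid_proper.
have UF : ProperFilter U by apply: ultra_proper.
(* [n] joins block [l] when [g + n] lies in [B l] for [U]-almost every [g]. *)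
exists (fun l => [set n | U [set g | B l (g + n)]]); split.
- split.
    move=> i j _ _ [n [/= Ui Uj]].
    have [g [Big Bjg]] := filter_ex (filterI Ui Uj).
    by apply: trivB => //; exists (g + n).
  apply/seteqP; split=> // n _; apply: contrapT => nS.
  (* If [n] is in no limit block, then for each [l] the [g] with [g + n] outside [B l] form a member
     of [U]; as there are finitely many [l], one [g] serves them all, against the covering. *)
  have [g nBg] : exists g, forall l, ~ B l (g + n).
    apply: (@filter_ex _ U); apply: filter_forall => l.
    have [Ul|//] := in_ultra_setVsetC [set g | B l (g + n)] ultraU.
    by exfalso; apply: nS; exists l.
  have : cover setT B (g + n) by rewrite coverB.
  by case=> l _ /nBg.
- apply/seteqP; split=> // n /= Un.
  have Uavoid : U (avoid [set n]) by apply: avoidU; exists [set n].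
  have [g [Bg]] := filter_ex (filterI Un Uavoid).
  by move=> /(_ n erefl).
- move=> l F finF FS; apply: (@filter_ex _ U).
  (* A finite intersection of members of [U] yields one translation for all of [F]. *)
  have : U (\bigcap_(n in F) [set g | B l (g + n)]).
    rewrite -(fset_setK finF); apply: filter_bigI => n.
    by rewrite in_fset_set// => /set_mem/FS.
  by [].
Qed.

Lemma syndetic_partition (G : zmodType) (P : set G -> Prop) :
  (forall S B, finitely_embeds S B -> P B -> P S) ->
  forall (L : nat) (B : 'I_L -> set G),
  partitioned_into B -> (forall l, P (B l)) ->
  exists (K : nat) (S : 'I_K -> set G),
    [/\ (K <= L)%N, partitioned_into S, forall k, syndetic (S k) &
        forall k, P (S k)].
Proof.
move=> Pemb; elim=> [|L IH] B partB PB.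
  by exists 0, B; split=> // -[].
have [synB|] := pselect (forall l, syndetic (B l)); first by exists L.+1, B.
move=> /existsNP[k nBk].
have [S [[trivS coverS] Sk0 embS]] := avoid_nonsyndetic partB nBk.
(* [lift k] enumerates the indices other than [k]; dropping the empty block [S k] leaves a partition
   into [L] blocks. *)
have [||K [T [KL ? ? ?]]] := IH (fun l => S (lift k l)).
- split.
    by move=> i j _ _ /(trivS _ _ I I) /lift_inj.
  apply/seteqP; split=> // n _.
  have : cover setT S n by rewrite coverS.
  case=> l _ Sl; case: (unliftP k l) => [j lj|lk].
    by exists j => //; rewrite -lj.
  by move: Sl; rewrite lk Sk0.
- by move=> l; apply: Pemb (PB (lift k l)).
- by exists K, T; split=> //; rewrite ltnW.
Qed.

(** Each test of the bounds involves only a finite piece of [S]; shifting it into [B] alters neither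
    the norm nor the coefficient sum. *)
Lemma riesz_finitely_embeds (R : realType) (V : lmodType R[i])
    (nrm : V -> \bar R) (G : zmodType) (f : G -> V) :
  (forall (g : G) (F : set G) (c : G -> R[i]), finite_set F ->
    nrm (\sum_(n \in F) c n *: f (g + n)) = nrm (\sum_(n \in F) c n *: f n)) ->
  forall S B : set G, finitely_embeds S B ->
  riesz_basic_sequence nrm B f -> riesz_basic_sequence nrm S f.
Proof.
move=> nrm_shift S B embS [a [b [a0 ab rieszB]]]; exists a, b; split=> // c.
set F := S `&` _ => finF.
have [g Bg] := embS F finF (@subIsetl _ _ _).
(* [c] transported along [n -> g + n] and set to [0] off [g + F]; this also discards the values of
   [c] outside [S]. *)
pose c' i := if i - g \in F then c (i - g) else 0.
have c'E n : F n -> c' (g + n) = c n.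
  by move=> Fn; rewrite /c' (addrC g) addrK mem_set.
have c'0 i : ~ [set g + n | n in F] i -> c' i = 0.
  rewrite /c'; case: ifPn => // /set_mem Fi nFi; exfalso; apply: nFi.
  by exists (i - g) => //; rewrite addrC subrK.
have gFB : [set g + n | n in F] `<=` B by move=> _ [n /Bg Bgn <-].
(* A general [phi] covers both the sum of squared moduli and the linear combination. *)
have transfer (M : nmodType) (phi : R[i] -> G -> M) :
    (forall n, phi 0 n = 0) ->
    \sum_(i \in B) phi (c' i) i = \sum_(n \in F) phi (c n) (g + n).
  move=> phi0; rewrite -(fsbig_widen _ _ _ gFB); last first.
    by move=> i [_ /c'0 ci] /=; rewrite ci phi0.
  rewrite (reindex_fsbig (fun n => g + n) F); last first.
    by split=> // n m _ _ /addrI.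
  by apply: eq_fsbigr => n /set_mem Fn; rewrite c'E.
have restrict (M : nmodType) (phi : R[i] -> G -> M) :
    (forall n, phi 0 n = 0) ->
    \sum_(n \in S) phi (c n) n = \sum_(n \in F) phi (c n) n.
  move=> phi0; apply/esym/fsbig_widen; first exact: subIsetl.
  move=> n [Sn nFn] /=; have [->//|cn] := eqVneq (c n) 0.
  by exfalso; apply: nFn.
have normc0_sqr : ComplexField.Normc.normc (0 : R[i]) ^+ 2 = 0.
  by rewrite ComplexField.Normc.normc0 expr0n.
have := rieszB c'.
rewrite (transfer _ (fun z _ => ComplexField.Normc.normc z ^+ 2))//.
rewrite (restrict _ (fun z _ => ComplexField.Normc.normc z ^+ 2))//.
rewrite (transfer _ (fun z n => z *: f n)); last by move=> n; rewrite scale0r.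
rewrite (restrict _ (fun z n => z *: f n)); last by move=> n; rewrite scale0r.
rewrite nrm_shift//; apply.
apply: (sub_finite_set _ (finite_image (fun n => g + n) finF)).
by move=> i [_ /= ci]; apply: contrapT => /c'0 ci0; rewrite ci0 eqxx in ci.
Qed.

Section exponentials.
Context {R : realType} {N : nat}.
Implicit Types (n m : 'rV[int]_N) (t : lebesgue_space R N).

Lemma exp_dotE n t : exp_dot n t =
  Complex (cos (2 * pi * dotp n t)) (sin (2 * pi * dotp n t)).
Proof.
rewrite /exp_dot.
have -> : 2 * (pi : R)%:C%C * 'i%C * (dotp n t)%:C%C =
    Complex 0 (2 * pi * dotp n t).
  by simpc; congr Complex; ring.
by rewrite /expC /= expR0; simpc.
Qed.

Lemma dotpD n m t : dotp (n + m) t = dotp n t + dotp m t.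
Proof.
rewrite /dotp -big_split; apply: eq_bigr => i _.
by rewrite mxE intrD mulrDl.
Qed.

Lemma exp_dotD n m t : exp_dot (n + m) t = exp_dot n t * exp_dot m t.
Proof.
rewrite !exp_dotE dotpD mulrDr cosD sinD; simpc.
by congr Complex; rewrite addrC mulrC.
Qed.

Lemma normc_exp_dot n t : ComplexField.Normc.normc (exp_dot n t) = 1.
Proof. by rewrite exp_dotE /= cos2Dsin2 sqrtr1. Qed.

Lemma L2norm_shift (A : set (lebesgue_space R N)) n (F : set 'rV[int]_N)
    (c : 'rV[int]_N -> R[i]) : finite_set F ->
  L2norm A (\sum_(m \in F) c m *: fourier_frame A (n + m)) =
  L2norm A (\sum_(m \in F) c m *: fourier_frame A m).
Proof.
move=> finF; rewrite !fsbig_finite//= /L2norm; congr Lnorm.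
congr (_ \_ A); apply/funext => t; congr EFin.
rewrite !fct_sumE.
(* The character [exp_dot n t] factors out of the sum; having modulus 1, it leaves the modulus at
   each [t] unchanged. *)
have -> : \sum_(m <- fset_set F) (c m *: fourier_frame A (n + m)) t =
    exp_dot n t * \sum_(m <- fset_set F) (c m *: fourier_frame A m) t.
  rewrite mulr_sumr; apply: eq_bigr => m _.
  rewrite !scalrfctE /fourier_frame exp_dotD -mulrA.
  exact: mulrCA.
by rewrite ComplexField.Normc.normcM normc_exp_dot mul1r.
Qed.
End exponentials.

Theorem theorem1p2 (R : realType) (N : nat) (A : set (lebesgue_space R N))
    (A_cube : A `<=` unit_cube)
    (A_measurable : measurable A)
    (A_pos : (0 < lebesgue_nd A)%E)
    (L : nat) (B : 'I_L -> set 'rV[int]_N)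
    (B_partition : partitioned_into B)
    (B_riesz : forall l,
      riesz_basic_sequence (L2norm A) (B l) (fourier_frame A)) :
  exists (K : nat) (S : 'I_K -> set 'rV[int]_N),
    [/\ (K <= L)%N,
        partitioned_into S,
        (forall k, syndetic (S k)) &
        (forall k, riesz_basic_sequence (L2norm A) (S k) (fourier_frame A))].
Proof.
pose P S := riesz_basic_sequence (L2norm A) S (fourier_frame A).
apply: (@syndetic_partition _ P _ _ _ B_partition B_riesz).
by apply: riesz_finitely_embeds => n F c; apply: L2norm_shift.
Qed.
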